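(* Let $d\ge1$ and let $\alpha$ and $\beta$ be two irrational vectors in $\mathbb{R}^d$. Then every bounded remainder set with respect to $\alpha$ is also a bounded remainder set with respect to $\beta$ if and only if $\alpha \in \mathbb{Z}\beta+\mathbb{Z}^d$.
   Context: A vector $\alpha = (\alpha_1,\dots,\alpha_d) \in \mathbb{R}^d$ is called irrational if $1, \alpha_1, \ldots, \alpha_d$ are linearly independent over $\mathbb{Q}$. We write $\mathbb{Z}\beta+\mathbb{Z}^d = \{ n\beta + m : n \in \mathbb{Z}, m \in \mathbb{Z}^d\}$ and $\mathbb{T}^d = \mathbb{R}^d/\mathbb{Z}^d$. For a bounded measurable set $S \subset \mathbb{R}^d$ let $\chi_S(x) = \sum_{k \in \mathbb{Z}^d} \mathbf{1}_S(x+k)$, a $\mathbb{Z}^d$-periodic function regarded as a function on $\mathbb{T}^d$. A bounded measurable set $S \subset \mathbb{R}^d$ is a bounded remainder set (BRS) with respect to an irrational vector $\alpha$ if there is a constant $C = C(S,\alpha)$ such that for every $n \geq 1$ and almost every $x \in \mathbb{T}^d$, $\left| \sum_{k=0}^{n-1} \chi_S(x+k\alpha) - n \operatorname{mes} S \right| \leq C$, where $\operatorname{mes}$ is Lebesgue measure. *)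

(* Defs.v *)
From HB Require Import structures.
From mathcomp Require Import all_boot all_order all_algebra.
From mathcomp Require Import all_classical all_reals all_analysis.
Set Implicit Arguments.
Unset Strict Implicit.
Unset Printing Implicit Defensive.
Import Order.TTheory GRing.Theory Num.Theory.
Import numFieldNormedType.Exports.

Local Open Scope classical_set_scope.
Local Open Scope ring_scope.

(* The Borel sets of R^d, generated by the coordinate functions, as in the
   library's instance for [d.-tuple T]. *)
Section borel_rV.
Context {R : realType} {d : nat}.

Definition rV_coord (i : 'I_d) (x : 'rV[R]_d) : measurableTypeR R := x ord0 i.

Let rV_set0 : g_sigma_preimage rV_coord set0.
Proof. exact: sigma_algebra0. Qed.

Let rV_setC A : g_sigma_preimage rV_coord A -> g_sigma_preimage rV_coord (~` A).
Proof. exact: sigma_algebraC. Qed.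

Let rV_bigcup (F : (set 'rV[R]_d)^nat) :
  (forall i, g_sigma_preimage rV_coord (F i)) ->
  g_sigma_preimage rV_coord (\bigcup_i F i).
Proof. exact: sigma_algebra_bigcup. Qed.

HB.instance Definition _ := @isMeasurable.Build default_measure_display
  'rV[R]_d (g_sigma_preimage rV_coord) rV_set0 rV_setC rV_bigcup.

Lemma measurable_rV_coord (i : 'I_d) : measurable_fun setT (rV_coord i).
Proof.
move=> _ Y mY; rewrite setTI; apply: sub_sigma_algebra => /=.
rewrite -bigcup_seq/=; exists i => /=; first by rewrite mem_index_enum.
by exists Y => //; rewrite setTI.
Qed.

Lemma measurable_fun_rVP d1 (T : measurableType d1) (f : T -> 'rV[R]_d) :
  (forall i, measurable_fun setT (rV_coord i \o f)) -> measurable_fun setT f.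
Proof.
move=> mf _ A mA; rewrite setTI.
suff: g_sigma_preimage (fun i => rV_coord i \o f) `<=` measurable.
  apply; rewrite g_sigma_preimage_comp; exists A => //.
  by rewrite setTI.
apply: smallest_sub; first exact: sigma_algebra_measurable.
rewrite -bigcup_seq; apply: bigcup_sub => i _ B [C mC <-].
exact: mf.
Qed.

End borel_rV.

Section lebesgue_step.
Context {R : realType} {d : nat}.

Definition cons_rV (p : measurableTypeR R * 'rV[R]_d) : 'rV[R]_d.+1 :=
  \row_i if unlift ord0 i is Some j then p.2 ord0 j else p.1.

Definition uncons_rV (r : 'rV[R]_d.+1) : measurableTypeR R * 'rV[R]_d :=
  (r ord0 ord0, \row_j r ord0 (lift ord0 j)).

Lemma cons_rVK : cancel cons_rV uncons_rV.
Proof.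
move=> [x v]; rewrite /uncons_rV /cons_rV mxE unlift_none; congr pair.
by apply/rowP => j; rewrite !mxE liftK.
Qed.

Lemma measurable_cons_rV : measurable_fun setT cons_rV.
Proof.
apply: measurable_fun_rVP => i; case: (unliftP ord0 i) => [j ->|->].
  rewrite (_ : _ \o _ = rV_coord j \o snd).
    by apply: measurableT_comp => //; exact: measurable_rV_coord.
  by rewrite funeqE => p /=; rewrite /rV_coord /cons_rV mxE liftK.
rewrite (_ : _ \o _ = fst)// funeqE => p /=.
by rewrite /rV_coord /cons_rV mxE unlift_none.
Qed.

Lemma measurable_uncons_rV : measurable_fun setT uncons_rV.
Proof.
apply/measurable_fun_pairP; split; first exact: measurable_rV_coord.
apply: measurable_fun_rVP => j.
rewrite (_ : _ \o _ = rV_coord (lift ord0 j)); last first.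
  by rewrite funeqE => r /=; rewrite /rV_coord mxE.
exact: measurable_rV_coord.
Qed.

HB.instance Definition _ := @isMeasurableFun.Build _ _ _ _ cons_rV
  measurable_cons_rV.

Variable mu : {sigma_finite_measure set 'rV[R]_d -> \bar R}.

Definition lebesgue_step : set 'rV[R]_d.+1 -> \bar R :=
  pushforward (lebesgue_measure \x mu)%E cons_rV.

Let lebesgue_step0 : lebesgue_step set0 = 0%E.
Proof. exact: measure0. Qed.

Let lebesgue_step_ge0 A : (0 <= lebesgue_step A)%E.
Proof. exact: measure_ge0. Qed.

Let lebesgue_step_sigma_additive : semi_sigma_additive lebesgue_step.
Proof. exact: measure_semi_sigma_additive. Qed.

HB.instance Definition _ := isMeasure.Build _ _ _ lebesgue_step
  lebesgue_step0 lebesgue_step_ge0 lebesgue_step_sigma_additive.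

Let lebesgue_step_sigma_finite : sigma_finite setT lebesgue_step.
Proof.
have /sigma_finiteP[F [TF ndF Foo]] :=
  sigma_finiteT (lebesgue_measure : {sigma_finite_measure set _ -> \bar R}).
have /sigma_finiteP[G [TG ndG Goo]] := sigma_finiteT mu.
exists (fun n => uncons_rV @^-1` (F n `*` G n)).
  apply/esym; rewrite -subTset => r _.
  have [n _ Fn] : (\bigcup_n F n) (uncons_rV r).1 by rewrite -TF.
  have [k _ Gk] : (\bigcup_n G n) (uncons_rV r).2 by rewrite -TG.
  exists (maxn n k) => //; split.
    by move: Fn; exact/subsetPset/ndF/leq_maxl.
  by move: Gk; exact/subsetPset/ndG/leq_maxr.
move=> n; have [mF Fn] := Foo n; have [mG Gn] := Goo n; split.
  rewrite -[X in measurable X]setTI.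
  by apply: measurable_uncons_rV => //; exact: measurableX.
rewrite /lebesgue_step /pushforward -comp_preimage.
rewrite (_ : _ \o _ = id); last by rewrite funeqE => p /=; rewrite cons_rVK.
by rewrite [ltLHS]product_measure1E// lte_mul_pinfty// ge0_fin_numE.
Qed.

HB.instance Definition _ := Measure_isSigmaFinite.Build _ _ _ lebesgue_step
  lebesgue_step_sigma_finite.

End lebesgue_step.

(* Lebesgue measure on the Borel sets of R^d, as the iterated product of the
   one-dimensional one (the unit mass at the only point when d = 0). *)
Fixpoint borel_lebesgue_rV (R : realType) (d : nat) :
    {sigma_finite_measure set 'rV[R]_d -> \bar R} :=
  if d is d'.+1 then lebesgue_step (borel_lebesgue_rV R d')
  else dirac (0 : 'rV[R]_0).

Lemma borel_lebesgue_rV_box (R : realType) (d : nat)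
    (A : 'I_d -> set (measurableTypeR R)) :
  (forall i, measurable (A i)) ->
  borel_lebesgue_rV R d [set x : 'rV[R]_d | forall i, A i (x ord0 i)] =
  (\prod_(i < d) lebesgue_measure (A i))%E.
Proof.
elim: d A => [|d IHd] A mA /=.
  by rewrite big_ord0 diracE mem_set//= => -[].
rewrite big_ord_recl -IHd// -product_measure1E//; last first.
  rewrite (_ : [set _ | _] = \bigcap_(i in [set: 'I_d])
      (rV_coord i @^-1` A (lift ord0 i))); last first.
    apply/seteqP; split => x /= Ax i; first by move=> _; exact: Ax.
    exact: Ax.
  apply: fin_bigcap_measurable; first exact: finite_finset.
  by move=> i _; rewrite -[X in measurable X]setTI; exact: measurable_rV_coord.
congr product_measure1; apply/seteqP; split => -[x v] /=.
  move=> Axv; split => [|i].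
    by have := Axv ord0; rewrite mxE unlift_none.
  by have := Axv (lift ord0 i); rewrite mxE liftK.
move=> [Ax Av] i; rewrite mxE.
by case: (unliftP ord0 i) => [j ->|->].
Qed.

(* The completion of the above: Lebesgue measure on R^d, together with its
   sigma-algebra of Lebesgue measurable sets. *)
Definition lebesgue_rV (R : realType) (d : nat) :=
  @completed_measure_extension _ _ _ (borel_lebesgue_rV R d).
Arguments lebesgue_rV : clear implicits.

Lemma lebesgue_rVE (R : realType) (d : nat) (A : set 'rV[R]_d) :
  measurable A -> lebesgue_rV R d A = borel_lebesgue_rV R d A.
Proof. exact: measurable_mu_extE. Qed.

Definition lebesgue_measurable (R : realType) (d : nat) (S : set 'rV[R]_d) :=
  (borel_lebesgue_rV R d)^*%mu.-cara.-measurable S.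

Section bounded_remainder.
Context {R : realType} {d : nat}.
Implicit Types (S : set 'rV[R]_d) (a b x : 'rV[R]_d).

(* Only used for bounded S, of finite measure. *)
Definition mes S : R := fine (lebesgue_rV R d S).

Definition irrational_vector a :=
  forall (q0 : rat) (q : 'I_d -> rat),
    ratr q0 * 1 + \sum_(i < d) ratr (q i) * a ord0 i = 0 :> R ->
    q0 = 0 /\ forall i, q i = 0.

Definition int_rV (k : 'rV[int]_d) : 'rV[R]_d := map_mx intr k.

Definition rotation_group b : set 'rV[R]_d :=
  [set n%:~R *: b + int_rV m | n in [set: int] & m in [set: 'rV[int]_d]].

(* The sum ranges over the finite support of its general term; the support is
   indeed finite when S is bounded. *)
Definition chi S x : R :=
  \sum_(k \in [set: 'rV[int]_d]) (\1_S (x + int_rV k) : R).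

Definition unit_cube : set 'rV[R]_d :=
  [set x | forall i, 0 <= x ord0 i < 1].

(* The torus R^d / Z^d, as a measure space, is the cube [0,1[^d. *)
Definition torus_ae (P : set 'rV[R]_d) :=
  {ae lebesgue_rV R d, forall x : 'rV[R]_d, unit_cube x -> P x}.

Definition bounded_remainder_set a S :=
  [/\ bounded_set S, lebesgue_measurable S &
    exists C : R, forall n : nat, (1 <= n)%N ->
      torus_ae [set x |
        `| \sum_(0 <= k < n) chi S (x + k%:R *: a) - n%:R * mes S | <= C]].

End bounded_remainder.

(* Main.v *)
Require Import Defs.
From HB Require Import structures.
From mathcomp Require Import all_boot all_order all_algebra.
From mathcomp Require Import all_classical all_reals all_analysis.
From mathcomp Require Import measurable_realfun zify lra.
Set Implicit Arguments.
Unset Strict Implicit.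
Unset Printing Implicit Defensive.
Import Order.TTheory GRing.Theory Num.Theory.
Import numFieldNormedType.Exports.
Local Open Scope classical_set_scope.
Local Open Scope ring_scope.

(** Both directions rest on the cohomological meaning of bounded discrepancy,
    but everything needed can be done by hand.

    If [alpha = n beta + m] with [n > 0], a Birkhoff sum along [beta] splits
    according to the residues modulo [n] of the summation index into [n] sums
    along [alpha], each evaluated at a translate of the base point, plus fewer
    than [n] terms ([bounded_remainder_set_mul]); so bounded discrepancy for
    [alpha] gives bounded discrepancy for [beta]. The case [n < 0] follows by
    running the sums backwards ([bounded_remainder_set_opp]), and [n = 0]
    would make [alpha] integral, hence not irrational. Translates of null sets
    have to be null ([negligible_shift]), whence the translation invariance of
    the measure.

    For the converse, fix a nonempty set [J] of coordinates, let [s_J] be the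
    sum of the coordinates in [J], and test the hypothesis on the set of the
    [x] in the unit cube such that the fractional part of [s_J x] is less than
    [a], where [a] is the fractional part of [s_J alpha]. This set has measure
    [a] ([borel_lebesgue_cube_arc]) and its discrepancy is that of the arc
    from 0 to [a] of the circle under the rotation by [s_J alpha]. Since the
    length of the arc is the angle of the rotation, the sum telescopes and is
    bounded ([arc_sum_hecke]). By hypothesis the same set has bounded
    discrepancy under [beta], i.e. the arc from 0 to [a] has bounded
    discrepancy under the rotation by [b = s_J beta], almost everywhere and
    then everywhere because the sums are right-continuous step functions
    ([bounded_arc_sum_of_ae]). A theorem of Kesten
    ([bounded_arc_sum_rotation]) gives [a = n b + m] with integers [n] and
    [m]. Taking for [J] each single coordinate shows that [alpha_i = n_i
    beta_i + m_i], taking for [J] all coordinates shows that [sum_i n_i beta_i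
    - n sum_i beta_i] is an integer, and the irrationality of [beta] forces
    all the [n_i] to be equal to [n].

    Kesten's theorem is usually derived from a spectral argument: a bounded
    transfer function [H] makes [exp (2 i pi H)] an eigenfunction of the
    rotation. For arcs there is a route that avoids measure theory. The
    two-sided sums form a cocycle with values in [Z - k a]; near a point where
    one of them almost attains the overall supremum the transfer function
    hardly varies, which means that [k b] being close to an integer forces [k
    a] to be close to an integer ([near_integer_transfer]). So [k b |-> k a]
    extends to a continuous endomorphism of the circle, and those are the
    multiplications by an integer ([circle_hom_linear]). *)

(** * Sums of the indicator of an arc along a rotation *)

(** The indicator of the arc from 0 to [a] of the circle when [0 <= a < 1] (see
    [arc_indicE]); written with floors, it telescopes along rotations whose
    angle is congruent to [a]. *)
Definition arc_indic {R : realType} (a t : R) : R :=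
  (Num.floor t)%:~R - (Num.floor (t - a))%:~R.

Lemma floorDz {R : realType} (t : R) (m : int) :
  Num.floor (t + m%:~R) = Num.floor t + m.
Proof. by rewrite floorDrz ?intr_int// intrKfloor. Qed.

Lemma arc_indicDz {R : realType} (a t : R) (m : int) :
  arc_indic a (t + m%:~R) = arc_indic a t.
Proof. by rewrite /arc_indic addrAC !floorDz !rmorphD/=; lra. Qed.

Lemma floor_right_constant {R : realType} (t : R) :
  exists2 e : R, 0 < e & forall u, t <= u < t + e -> Num.floor u = Num.floor t.
Proof.
exists ((Num.floor t + 1)%:~R - t); first by rewrite subr_gt0 floorD1_gt.
move=> u /andP[tu ut]; apply: floor_def; apply/andP; split.
  exact: le_trans (floor_le t) tu.
by lra.
Qed.

Lemma arc_indic_right_constant {R : realType} (a t : R) :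
  exists2 e : R, 0 < e &
    forall u, t <= u < t + e -> arc_indic a u = arc_indic a t.
Proof.
have [e e0 he] := floor_right_constant t.
have [e' e'0 he'] := floor_right_constant (t - a).
exists (Num.min e e'); first by rewrite lt_min e0.
move=> u /andP[tu]; rewrite -ltrBlDl lt_min => /andP[ue ue'].
rewrite /arc_indic (he u) ?(he' (u - a)) //; apply/andP; split; lra.
Qed.

Definition arc_sum {R : realType} (a b : R) (n : nat) (t : R) : R :=
  \sum_(0 <= k < n) arc_indic a (t + k%:R * b) - n%:R * a.

Lemma arc_sumDz {R : realType} (a b : R) n (t : R) (m : int) :
  arc_sum a b n (t + m%:~R) = arc_sum a b n t.
Proof.
rewrite /arc_sum; congr (_ - _); apply: eq_bigr => k _.
by rewrite addrAC arc_indicDz.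
Qed.

Lemma arc_sum_right_constant {R : realType} (a b t : R) n :
  exists2 e : R, 0 < e &
    forall u, t <= u < t + e -> arc_sum a b n u = arc_sum a b n t.
Proof.
elim: n => [|n [e e0 he]].
  by exists 1 => // u _; rewrite /arc_sum !big_geq.
have [e' e'0 he'] := arc_indic_right_constant a (t + n%:R * b).
exists (Num.min e e'); first by rewrite lt_min e0.
move=> u /andP[tu]; rewrite -ltrBlDl lt_min => /andP[ue ue'].
have := he u; rewrite /arc_sum !big_nat_recr//= => heu.
rewrite [arc_indic a (u + _)]he'; last by apply/andP; split; lra.
have : t <= u < t + e by apply/andP; split; lra.
by move=> /heu; lra.
Qed.

Lemma arc_indicE {R : realType} (a s : R) (n : int) : 0 <= a < 1 ->
  n%:~R <= s < (n + 1)%:~R -> arc_indic a s = if s < n%:~R + a then 1 else 0.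
Proof.
move=> /andP[a0 a1] sn; rewrite /arc_indic (floor_def sn); move: sn.
rewrite rmorphD/= => /andP[ns sn].
case: ltP => h; rewrite (@floor_def _ _ (if s < n%:~R + a then n - 1 else n)).
- by rewrite h rmorphB/=; lra.
- by rewrite h subrK rmorphB/=; apply/andP; split; lra.
- by rewrite ltNge h/= subrr.
- by rewrite ltNge h/= rmorphD/=; apply/andP; split; lra.
Qed.

Lemma arc_indic01 {R : realType} (a s : R) : 0 <= a < 1 ->
  arc_indic a s = 0 \/ arc_indic a s = 1.
Proof.
by move=> a01; rewrite (arc_indicE a01 (floor_itv s)); case: ifP; [right|left].
Qed.

Lemma arc_sumSl {R : realType} (a b t : R) n :
  arc_sum a b n.+1 t = arc_indic a t - a + arc_sum a b n (t + b).
Proof.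
rewrite /arc_sum big_nat_recl// mul0r addr0.
under eq_bigr => k _ do rewrite -natr1 mulrDl mul1r (addrC (_ * b)) addrA.
by rewrite -natr1; lra.
Qed.

Lemma arc_sumSr {R : realType} (a b t : R) n :
  arc_sum a b n.+1 t = arc_sum a b n t + (arc_indic a (t + n%:R * b) - a).
Proof. by rewrite /arc_sum big_nat_recr//= -natr1; lra. Qed.

(** When the angle is congruent to the length of the arc, each term is a
    difference of consecutive values of the floor along the orbit. *)
Lemma arc_sum_hecke {R : realType} (a t : R) (N : int) n :
  `|arc_sum a (a + N%:~R) n t| <= 1.
Proof.
set b := a + N%:~R.
have -> : arc_sum a b n t =
    (Num.floor (t - b + n%:R * b))%:~R - (Num.floor (t - b))%:~R - n%:R * b.
  elim: n => [|n IHn]; first by rewrite /arc_sum big_geq// !mul0r addr0; lra.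
  rewrite arc_sumSr IHn /arc_indic.
  rewrite (_ : t - b + n.+1%:R * b = t + n%:R * b); last by rewrite -natr1; lra.
  rewrite (_ : t + n%:R * b - a = t - b + n%:R * b + N%:~R).
    by rewrite floorDz rmorphD/= -natr1 /b; lra.
  by rewrite /b; lra.
have := floor_itv (t - b + n%:R * b); have := floor_itv (t - b).
rewrite !rmorphD/= => /andP[? ?] /andP[? ?].
by rewrite ler_norml; apply/andP; split; lra.
Qed.

(** * Arcs of bounded discrepancy *)

(** Birkhoff sums extended to negative times, in the only way that keeps the
    cocycle identity [arc_cocycleD].  Unlike the one over positive times, the
    supremum over all integer times changes by the cocycle itself when the base
    point moves along its orbit. *)
Definition arc_cocycle {R : realType} (a b : R) (k : int) (t : R) : R :=
  match k with
  | Posz n => arc_sum a b n t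
  | Negz n => - arc_sum a b n.+1 (t - n.+1%:R * b)
  end.

Lemma arc_cocycle0 {R : realType} (a b t : R) : arc_cocycle a b 0 t = 0.
Proof. by rewrite /arc_cocycle/= /arc_sum big_geq// mul0r subr0. Qed.

Lemma arc_cocycleS {R : realType} (a b t : R) (k : int) :
  arc_cocycle a b (k + 1) t =
  arc_cocycle a b k t + (arc_indic a (t + k%:~R * b) - a).
Proof.
case: k => n; first by rewrite -PoszD addn1 /arc_cocycle arc_sumSr.
case: n => [|n].
  rewrite (_ : Negz 0 + 1 = 0)// arc_cocycle0 /arc_cocycle arc_sumSl.
  rewrite /arc_sum big_geq// NegzE/= mulrNz mulNr.
  by rewrite mul0r subr0 addr0 mulr1z; lra.
rewrite (_ : Negz n.+1 + 1 = Negz n); last first.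
  by rewrite !NegzE -(addn1 n.+1) PoszD opprD addrNK.
rewrite /arc_cocycle [X in _ = - X + _]arc_sumSl NegzE mulrNz mulNr.
rewrite (_ : t - n.+2%:R * b + b = t - n.+1%:R * b).
  by rewrite -pmulrn; lra.
by rewrite -(natr1 n.+1); lra.
Qed.

Lemma arc_cocycleD {R : realType} (a b t : R) (k l : int) :
  arc_cocycle a b (k + l) t =
  arc_cocycle a b k t + arc_cocycle a b l (t + k%:~R * b).
Proof.
elim: l => [|n IH|n IH]; first by rewrite arc_cocycle0 !addr0.
  rewrite -addn1 PoszD addrA !arc_cocycleS IH !rmorphD/= mulrDl.
  by rewrite !addrA.
move: IH; rewrite -(subrK 1 (- Posz n)) addrA !arc_cocycleS.
rewrite -(addn1 n) PoszD opprD !rmorphD/= !mulrDl !addrA.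
by lra.
Qed.

Lemma arc_cocycle_mod1 {R : realType} (a b t : R) (k : int) :
  exists m : int, arc_cocycle a b k t = m%:~R - k%:~R * a.
Proof.
have H n u : exists m : int, arc_sum a b n u = m%:~R - n%:R * a.
  rewrite /arc_sum /arc_indic.
  exists (\sum_(0 <= k < n)
    (Num.floor (u + k%:R * b) - Num.floor (u + k%:R * b - a))).
  by rewrite raddf_sum/=; congr (_ - _); apply: eq_bigr => i _; rewrite rmorphB.
case: k => n /=; first exact: H.
have [m ->] := H n.+1 (t - n.+1%:R * b); exists (- m).
by rewrite NegzE !mulrNz -pmulrn; lra.
Qed.

Lemma arc_cocycleDz {R : realType} (a b : R) k (t : R) (m : int) :
  arc_cocycle a b k (t + m%:~R) = arc_cocycle a b k t.
Proof.
case: k => n; rewrite /arc_cocycle; first exact: arc_sumDz.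
by rewrite addrAC arc_sumDz.
Qed.

Lemma arc_cocycle_right_constant {R : realType} (a b t : R) k :
  exists2 e : R, 0 < e &
    forall u, t <= u < t + e -> arc_cocycle a b k u = arc_cocycle a b k t.
Proof.
case: k => n; first exact: arc_sum_right_constant.
have [e e0 he] := arc_sum_right_constant a b (t - n.+1%:R * b) n.+1.
exists e => // u /andP[tu ut]; rewrite /arc_cocycle he//.
by apply/andP; split; lra.
Qed.

(** Choose [k0] and [t0] such that the cocycle at [k0], [t0] is within [eps] of
    its overall supremum; by right-continuity it keeps this value for
    [t0 <= t < t0 + delta].  If [t0 + k b] falls into this interval modulo 1,
    then the cocycle at [k], [t0] is less than [eps], because adding to it the
    almost maximal value at [t0 + k b] cannot exceed the supremum; exchanging
    the two points, it is also greater than [- eps].  As the cocycle at [k] is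
    congruent to [- k a], this puts [k a] within [eps] of an integer. *)
Lemma near_integer_transfer {R : realType} (a b C : R) :
  (forall n t, `|arc_sum a b n t| <= C) ->
  forall eps : R, 0 < eps -> exists2 delta : R, 0 < delta &
    forall k l : int, `|k%:~R * b + l%:~R| < delta ->
      exists m : int, `|k%:~R * a + m%:~R| <= eps.
Proof.
move=> hC eps eps0.
have hC' k t : arc_cocycle a b k t <= C.
  case: k => n; rewrite /arc_cocycle.
    by have := hC n t; rewrite ler_norml => /andP[].
  by have := hC n.+1 (t - n.+1%:R * b); rewrite ler_norml => /andP[? ?]; lra.
pose V := [set s | exists k t, s = arc_cocycle a b k t].
have supV : has_sup V.
  split; first by exists (arc_cocycle a b 0 0); exists 0, 0.
  by exists C => _ [k [t ->]].
have leV k t : arc_cocycle a b k t <= sup V.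
  by apply: sup_upper_bound => //; exists k, t.
have [_ [k0 [t0 ->]] near_sup] := sup_adherent eps0 supV.
have [delta delta0 hdelta] := arc_cocycle_right_constant a b t0 k0.
have main (k l : int) : 0 <= k%:~R * b + l%:~R < delta ->
    exists m : int, `|k%:~R * a + m%:~R| <= eps.
  move=> /andP[kl0 kl1]; have [m Em] := arc_cocycle_mod1 a b t0 k.
  exists (- m).
  have Ek0 : arc_cocycle a b k0 (t0 + k%:~R * b) = arc_cocycle a b k0 t0.
    rewrite -(arc_cocycleDz _ _ _ _ l) hdelta//.
    by apply/andP; split; lra.
  have := leV (k + k0) t0; rewrite arc_cocycleD Ek0 Em => h1.
  have := leV (k0 - k) (t0 + k%:~R * b).
  have := arc_cocycleD a b t0 k (k0 - k); rewrite addrCA subrr addr0 Em.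
  by move=> h2 h3; rewrite mulrNz ler_norml; apply/andP; split; lra.
exists delta => // k l; case: (leP 0 (k%:~R * b + l%:~R)) => [kl0|kl0].
  by rewrite ger0_norm// => kl1; apply: (main k l); rewrite kl0.
rewrite ltr0_norm// => kl1; have [|m hm] := main (- k) (- l).
  by rewrite !mulrNz; apply/andP; split; lra.
exists (- m); rewrite (_ : _ + _ = - ((- k)%:~R * a + m%:~R)) ?normrN//.
by rewrite !mulrNz; lra.
Qed.

Lemma approx_int {R : realType} (x : R) :
  (forall eta : R, 0 < eta -> exists m : int, `|x + m%:~R| <= eta) ->
  exists m : int, x = m%:~R.
Proof.
move=> hx; exists (Num.floor x); apply/eqP; rewrite eq_le floor_le andbT.
rewrite leNgt; apply/negP => fx.
have fx1 := floorD1_gt x.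
pose g := x - (Num.floor x)%:~R; pose h := (Num.floor x + 1)%:~R - x.
have [|m] := hx (Num.min g h / 2).
  by rewrite divr_gt0// lt_min !subr_gt0 fx fx1.
have [g0 h0] : 0 < g /\ 0 < h by rewrite !subr_gt0.
have [lg lh] : Num.min g h <= g /\ Num.min g h <= h.
  by rewrite !ge_min !lexx orbT.
rewrite ler_norml => /andP[].
have [|] := leP (- m) (Num.floor x).
  rewrite -(ler_int R) mulrNz => ? ? ?; suff: g <= 0 by lra.
  by rewrite /g in lg lh *; lra.
rewrite -lezD1 -(ler_int R) mulrNz => ? ? ?.
suff: h <= 0 by lra.
by rewrite /h in lg lh *; lra.
Qed.

(** Below half of each positive element [g] of [Z b + Z] there is another one:
    [1] and [b] are not both multiples of [g], so one of them leaves a nonzero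
    remainder [r] in the division by [g], and either [r] or [g - r] is at most
    [g / 2]. *)
Lemma small_combination {R : realType} (b : R) :
  (forall k l : int, k%:~R * b + l%:~R = 0 -> k = 0) ->
  forall eta : R, 0 < eta ->
    exists k l : int, 0 < k%:~R * b + l%:~R < eta.
Proof.
move=> irrb.
have half (k l : int) : 0 < k%:~R * b + l%:~R -> exists k' l' : int,
    0 < k'%:~R * b + l'%:~R <= (k%:~R * b + l%:~R) / 2.
  set g := k%:~R * b + l%:~R => g0.
  have [p [q [z0 z1]]] : exists p q : int,
      0 < p%:~R * b + q%:~R /\ p%:~R * b + q%:~R < g.
    have mod_g (p q : int) (n := Num.floor ((p%:~R * b + q%:~R) / g)) :
        0 <= (p - n * k)%:~R * b + (q - n * l)%:~R < g.
      have -> : (p - n * k)%:~R * b + (q - n * l)%:~R =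
          (p%:~R * b + q%:~R) - n%:~R * g.
        by rewrite /g !rmorphB !rmorphM/=; lra.
      rewrite subr_ge0 ltrBlDr -ler_pdivlMr// floor_le.
      rewrite (_ : g + _ = (n + 1)%:~R * g); last by rewrite rmorphD/=; lra.
      by rewrite -ltr_pdivrMr// floorD1_gt.
    have := mod_g 0 1; have := mod_g 1 0.
    set n := Num.floor _; set n' := Num.floor _.
    move=> /andP[u0 u1] /andP[v0 v1].
    move: u0; rewrite le_eqVlt => /predU1P[/esym u0|u0]; last first.
      by exists (1 - n * k), (0 - n * l).
    move: v0; rewrite le_eqVlt => /predU1P[/esym v0|v0]; last first.
      by exists (0 - n' * k), (1 - n' * l).
    have := irrb _ _ u0; have := irrb _ _ v0.
    rewrite sub0r => /eqP; rewrite oppr_eq0 mulf_eq0 => /orP[]/eqP.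
      move=> n'0; move: v0; rewrite n'0 !mul0r !subr0 add0r mulr1z.
      by move=> /eqP; rewrite oner_eq0.
    by move=> -> /eqP; rewrite mulr0 subr0.
  have [h|h] := leP (p%:~R * b + q%:~R) (g / 2).
    by exists p, q; rewrite z0 h.
  exists (k - p), (l - q); rewrite !rmorphB/=; move: z0 z1 h; rewrite /g => *.
  by apply/andP; split; lra.
have pow n : exists k l : int, 0 < k%:~R * b + l%:~R <= 2 ^- n.
  elim: n => [|n [k [l /andP[kl0 kl1]]]].
    by exists 0, 1; rewrite mul0r add0r expr0 invr1 lexx ltr01.
  have [k' [l' /andP[h1 h2]]] := half k l kl0.
  exists k', l'; rewrite h1 (le_trans h2)// exprS invfM mulrC.
  by rewrite ler_pM2l// ?invr_gt0.
move=> eta eta0.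
have [k [l /andP[h1 h2]]] := pow (Num.bound eta^-1).
exists k, l; rewrite h1 (le_lt_trans h2)//.
by rewrite invf_plt ?posrE ?exprn_gt0// upper_nthrootP.
Qed.

(** The homomorphism [k b |-> k a] from a dense subgroup of the circle to the
    circle is continuous at 0, hence a multiplication by an integer. Locally
    it lifts to an additive map between subgroups of the line; bounded on an
    interval, the lift is Lipschitz at 0 ([lin]). Comparing an arbitrary
    element with a fixed one through a tiny third one then shows that the lift
    is linear modulo the integers ([slope]), and its slope is an integer
    because 1 is sent to an integer. *)
Lemma circle_hom_linear {R : realType} (a b : R) :
  (forall k l : int, k%:~R * b + l%:~R = 0 -> k = 0) ->
  (forall eps : R, 0 < eps -> exists2 delta : R, 0 < delta &
     forall k l : int, `|k%:~R * b + l%:~R| < delta ->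
       exists m : int, `|k%:~R * a + m%:~R| <= eps) ->
  exists m l : int, a = m%:~R * b + l%:~R.
Proof.
move=> irrb cont.
(* [L] is the lifted graph of [k b |-> k a] in the plane. *)
pose L g h := exists k l m : int,
  g = k%:~R * b + l%:~R /\ h = k%:~R * a + m%:~R.
have LD g h g' h' : L g h -> L g' h' -> L (g + g') (h + h').
  move=> [k [l [m [-> ->]]]] [k' [l' [m' [-> ->]]]].
  by exists (k + k'), (l + l'), (m + m'); rewrite !rmorphD/=; split; lra.
have LM (n : int) g h : L g h -> L (n%:~R * g) (n%:~R * h).
  move=> [k [l [m [-> ->]]]].
  by exists (n * k), (n * l), (n * m); rewrite !rmorphM/=; split; lra.
have LB g h g' h' : L g h -> L g' h' -> L (g - g') (h - h').
  by move=> L1 /(LM (-1)); rewrite !mulrNz !mulN1r; exact: LD.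
have Lz (m : int) : L 0 m%:~R.
  by exists 0, 0, m; rewrite !mul0r !add0r.
have L0 h : L 0 h -> exists m : int, h = m%:~R.
  move=> [k [l [m [/esym kl ->]]]]; have k0 := irrb _ _ kl.
  by exists m; rewrite k0 mul0r add0r.
have small_int (m : int) : `|m%:~R : R| < 1 -> m = 0.
  by rewrite -intr_norm -[1]/(1%:~R) ltr_int => m1; lia.
have [delta delta0 hdelta] := cont (1 / 4) ltac:(lra).
have step g h : L g h -> `|g| < delta ->
    exists m : int, L g (h + m%:~R) /\ `|h + m%:~R| <= 1 / 4.
  move=> [k [l [m [-> ->]]]] /hdelta[m' hm'].
  exists (m' - m); rewrite (_ : _ + m%:~R + _ = k%:~R * a + m'%:~R); last first.
    by rewrite rmorphB/=; lra.
  by split => //; exists k, l, m'.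
(* Two consecutive multiples of [h] differ by at most 1/4, so that the integer
   correction provided by [step] cannot jump along the multiples. *)
have mult n g h : L g h -> `|h| <= 1 / 4 -> n%:R * `|g| < delta ->
    n%:R * `|h| <= 1 / 4.
  move=> Lgh h4; elim: n => [|n IH] nd; first by rewrite mul0r; lra.
  have {}IH : n%:R * `|h| <= 1 / 4.
    by apply: IH; move: nd; rewrite -natr1; have := normr_ge0 g; lra.
  have [||m [_ hm]] := step (n.+1%:R * g) (n.+1%:R * h).
  - exact: (LM n.+1).
  - by rewrite normrM normr_nat.
  have m0 : m = 0.
    apply: small_int; rewrite (_ : m%:~R = n.+1%:R * h + m%:~R - n%:R * h - h).
      apply: le_lt_trans (ler_normB _ _) _.
      have := ler_normB (n.+1%:R * h + m%:~R) (n%:R * h).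
      by rewrite [`|n%:R * h|]normrM normr_nat; lra.
    by rewrite -natr1; lra.
  by move: hm; rewrite m0 addr0 normrM normr_nat.
have lin g h : L g h -> `|g| < delta -> `|h| <= 1 / 4 -> delta * `|h| <= `|g|.
  move=> Lgh gd h4; have [g0|g0] := eqVneq g 0.
    move: Lgh; rewrite g0 normr0 => /L0[m hm].
    have -> : h = 0 by rewrite hm (small_int m)// -hm; lra.
    by rewrite normr0 mulr0.
  have g0' : 0 < `|g| by rewrite normr_gt0.
  pose x := delta / `|g| / 2; have x0 : 0 <= x by rewrite !divr_ge0// ltW.
  have [n /andP[nx xn]] : exists n : nat, n%:R <= x < n.+1%:R.
    by exists (Num.truncn x); exact: truncn_itv.
  have Ex : x * `|g| = delta / 2 by rewrite /x mulrAC divfK// gt_eqF.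
  have h1 : n%:R * `|h| <= 1 / 4.
    apply: mult Lgh h4 _; apply: (@le_lt_trans _ _ (delta / 2)); last by lra.
    by rewrite -Ex ler_wpM2r// ltW.
  have h2 : x * `|h| <= 1 / 2.
    apply: (@le_trans _ _ (n.+1%:R * `|h|)).
      by rewrite ler_wpM2r// ltW.
    by rewrite -natr1; lra.
  have : x * `|h| * `|g| <= 1 / 2 * `|g| by rewrite ler_wpM2r// ltW.
  by rewrite mulrAC Ex; lra.
(* With [g1] below [delta / 4], the lift of [g1] and its approximation along a
   smaller [g3] are each at most 1/4, which rules out an integer offset. *)
have d4 : 0 < delta / 4 by lra.
have [k1 [l1]] := small_combination irrb d4.
set g1 := k1%:~R * b + l1%:~R => /andP[g1_gt0 g1d].
have [||m1 [L1 h1_le]] := @step g1 (k1%:~R * a + 0%:~R).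
- by exists k1, l1, 0.
- by rewrite gtr0_norm//; lra.
set h1 := _ + m1%:~R in L1 h1_le.
have slope g h : L g h -> exists m : int, h - h1 / g1 * g = m%:~R.
  move=> Lgh; apply: approx_int => eta eta0.
  have W0 : 0 < 2 * (g1 + `|g|) by have := normr_ge0 g; lra.
  pose bd := Num.min (delta / 4) (eta * delta * g1 / (2 * (g1 + `|g|))).
  have bd0 : 0 < bd by rewrite lt_min d4 divr_gt0// !mulr_gt0.
  have [k3 [l3]] := small_combination irrb bd0.
  set g3 := k3%:~R * b + l3%:~R.
  rewrite lt_min => /and3P[g3_gt0 g3d]; rewrite ltr_pdivlMr// => g3_eta.
  have [||m3 [L3 h3_le]] := @step g3 (k3%:~R * a + 0%:~R).
  - by exists k3, l3, 0.
  - by rewrite gtr0_norm//; lra.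
  set h3 := _ + m3%:~R in L3 h3_le.
  pose s := h3 / g3.
  have s_le : delta * `|s| <= 1.
    rewrite /s normf_div (gtr0_norm g3_gt0) mulrA ler_pdivrMr// mul1r.
    by have := lin _ _ L3; rewrite (gtr0_norm g3_gt0); apply => //; lra.
  (* Divide [x] by [g3]: the quotient contributes the slope [s], and the
     remainder, which is less than [g3], a negligible error. *)
  have near_s x y : L x y ->
      exists m : int, delta * `|y + m%:~R - x * s| <= 2 * g3.
    move=> Lxy; pose q := Num.floor (x / g3).
    have r0 : 0 <= x - q%:~R * g3 by rewrite subr_ge0 -ler_pdivlMr// floor_le.
    have r1 : x - q%:~R * g3 < g3.
      rewrite ltrBlDr (_ : g3 + _ = (q + 1)%:~R * g3).
        by rewrite -ltr_pdivrMr// floorD1_gt.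
      by rewrite rmorphD/=; lra.
    have [|m [Lr hr]] := step _ _ (LB _ _ _ _ Lxy (LM q _ _ L3)).
      by rewrite ger0_norm//; lra.
    exists m; have := lin _ _ Lr; rewrite (ger0_norm r0) => /(_ _ hr) lr.
    have {}lr : delta * `|y - q%:~R * h3 + m%:~R| <= g3.
      by apply: le_trans (ltW r1); apply: lr; lra.
    have -> : y + m%:~R - x * s =
        (y - q%:~R * h3 + m%:~R) - (x - q%:~R * g3) * s.
      have : h3 = g3 * s by rewrite /s mulrC divfK// gt_eqF.
      by move: (h3) (s) => ? ? ->; lra.
    apply: (le_trans (ler_wpM2l (ltW delta0) (ler_normB _ _))).
    rewrite mulrDr normrM (ger0_norm r0) mulrCA.
    have : (x - q%:~R * g3) * (delta * `|s|) <= (x - q%:~R * g3) * 1.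
      exact: ler_wpM2l.
    by lra.
  have [m' hm'] := near_s _ _ L1.
  have m'0 : m' = 0.
    apply: small_int; rewrite -(ltr_pM2l delta0) mulr1.
    rewrite (_ : m'%:~R = (h1 + m'%:~R - g1 * s) - h1 + g1 * s); last by lra.
    apply: le_lt_trans (ler_wpM2l (ltW delta0) (ler_normD _ _)) _.
    have := ler_wpM2l (ltW delta0) (ler_normB (h1 + m'%:~R - g1 * s) h1).
    have : g1 * (delta * `|s|) <= g1 * 1 by rewrite ler_pM2l.
    have : delta * `|h1| <= delta * (1 / 4) by rewrite ler_pM2l.
    rewrite !mulrDr [`|g1 * s|]normrM (gtr0_norm g1_gt0).
    by lra.
  move: hm'; rewrite m'0 addr0 => hm'.
  have [m hm] := near_s _ _ Lgh; exists m.
  have -> : h - h1 / g1 * g + m%:~R =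
      (h + m%:~R - g * s) - (h1 - g1 * s) / g1 * g.
    by rewrite mulrBl [g1 * s]mulrC mulfK ?gt_eqF//; lra.
  rewrite -(ler_pM2l g1_gt0) -(ler_pM2l delta0).
  apply: (@le_trans _ _ (2 * g3 * (g1 + `|g|))); last by lra.
  apply: (le_trans (ler_wpM2l (ltW delta0)
    (ler_wpM2l (ltW g1_gt0) (ler_normB _ _)))).
  rewrite !normrM (normfV g1) (gtr0_norm g1_gt0).
  have h1' : g1 * (delta * `|h + m%:~R - g * s|) <= g1 * (2 * g3).
    by rewrite ler_pM2l.
  have h2' : `|g| * (delta * `|h1 - g1 * s|) <= `|g| * (2 * g3).
    exact: ler_wpM2l.
  rewrite mulrDr mulrDr.
  have -> : g1 * (`|h1 - g1 * s| / g1 * `|g|) = `|h1 - g1 * s| * `|g|.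
    by rewrite mulrA mulrCA divff ?gt_eqF// mulr1.
  by lra.
have [|m] := slope 1 0; first by exists 0, 1, 0; rewrite !mul0r add0r addr0.
have [|m' hm' hm] := slope b a.
  by exists 1, 0, 0; rewrite !mul1r !addr0.
exists (- m), m'; rewrite mulrNz -hm -hm'; lra.
Qed.

(** Kesten's theorem for an arc starting at 0. *)
Lemma bounded_arc_sum_rotation {R : realType} (a b C : R) :
  (forall k l : int, k%:~R * b + l%:~R = 0 -> k = 0) ->
  (forall n t, `|arc_sum a b n t| <= C) ->
  exists m l : int, a = m%:~R * b + l%:~R.
Proof.
by move=> irrb hC; apply: circle_hom_linear irrb (near_integer_transfer hC).
Qed.

(** * Translation invariance of the Lebesgue measure *)

Section translation.
Context {R : realType}.

Definition shift1 (c : R) (t : measurableTypeR R) : measurableTypeR R := t + c.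

Lemma measurable_shift1 c : measurable_fun setT (shift1 c).
Proof. by apply: measurable_funD. Qed.

HB.instance Definition _ c :=
  @isMeasurableFun.Build _ _ _ _ (shift1 c) (measurable_shift1 c).

Lemma lebesgue_measure_shift c (A : set (measurableTypeR R)) : measurable A ->
  lebesgue_measure (shift1 c @^-1` A) = lebesgue_measure A.
Proof.
move=> mA; rewrite -[LHS]/(pushforward lebesgue_measure (shift1 c) A).
apply/esym/lebesgue_measure_unique => //= _ [[a b]] _ <-.
rewrite /pushforward (_ : _ @^-1` _ = `](a - c), (b - c)]%classic).
  rewrite !lebesgue_measure_itv/= !lte_fin ltrD2r.
  by case: ifP => // _; rewrite -!EFinB; congr (_%:E); lra.
apply/seteqP; split => t /=; rewrite /shift1 !in_itv/= => /andP[? ?];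
  by apply/andP; split; lra.
Qed.

Definition shift_rV d (v x : 'rV[R]_d) : 'rV[R]_d := x + v.

Lemma measurable_shift_rV d (v : 'rV[R]_d) : measurable_fun setT (shift_rV v).
Proof.
apply: measurable_fun_rVP => i.
rewrite (_ : _ \o _ = shift1 (v ord0 i) \o rV_coord i).
  by apply: measurableT_comp => //; exact: measurable_rV_coord.
by apply/funext => x; rewrite /= /rV_coord /shift_rV mxE.
Qed.

HB.instance Definition _ d (v : 'rV[R]_d) :=
  @isMeasurableFun.Build _ _ _ _ (shift_rV v) (measurable_shift_rV v).

Definition shift_pair d (v : 'rV[R]_d.+1) (p : measurableTypeR R * 'rV[R]_d) :
    measurableTypeR R * 'rV[R]_d :=
  (shift1 (uncons_rV v).1 p.1, shift_rV (uncons_rV v).2 p.2).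

Lemma measurable_shift_pair d (v : 'rV[R]_d.+1) :
  measurable_fun setT (shift_pair v).
Proof.
apply/measurable_fun_pairP; split.
  rewrite (_ : _ \o _ = shift1 (uncons_rV v).1 \o fst)//.
  by apply: measurableT_comp => //; exact: measurable_shift1.
rewrite (_ : _ \o _ = shift_rV (uncons_rV v).2 \o snd)//.
by apply: measurableT_comp => //; exact: measurable_shift_rV.
Qed.

HB.instance Definition _ d (v : 'rV[R]_d.+1) :=
  @isMeasurableFun.Build _ _ _ _ (shift_pair v) (measurable_shift_pair v).

(** In the coordinates [cons_rV] a translation acts separately on the first
    coordinate and on the others, so that the translated measure agrees with the
    product measure on rectangles. *)
Lemma borel_lebesgue_rV_shift d (v : 'rV[R]_d) (A : set 'rV[R]_d) :
  measurable A ->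
  borel_lebesgue_rV R d (shift_rV v @^-1` A) = borel_lebesgue_rV R d A.
Proof.
elim: d v A => [|d IHd] v A mA.
  rewrite (_ : shift_rV v = id)//.
  by apply/funext => x; rewrite /shift_rV (thinmx0 v) addr0.
rewrite /= /lebesgue_step /pushforward.
have -> : cons_rV @^-1` (shift_rV v @^-1` A) =
          shift_pair v @^-1` (cons_rV @^-1` A).
  apply/funext => p; rewrite /preimage/=; congr (A _).
  apply/rowP => i; rewrite /shift_rV /cons_rV !mxE.
  by case: unliftP => [j ->|->]; rewrite ?mxE.
have mcA : measurable (cons_rV @^-1` A).
  by rewrite -[X in measurable X]setTI; exact: measurable_cons_rV.
apply/esym; apply: (@product_measure_unique _ _ _ _ _ _ _
  (pushforward (lebesgue_measure \x borel_lebesgue_rV R d)%E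
    (shift_pair v))) => //.
move=> B C mB mC; rewrite -[LHS]/((lebesgue_measure \x borel_lebesgue_rV R d)%E
  ((shift1 (uncons_rV v).1 @^-1` B) `*` (shift_rV (uncons_rV v).2 @^-1` C))).
rewrite product_measure1E; last 2 first.
- by rewrite -[X in measurable X]setTI; exact: measurable_shift1.
- by rewrite -[X in measurable X]setTI; exact: measurable_shift_rV.
by congr (_ * _)%E; [exact: lebesgue_measure_shift|exact: IHd].
Qed.

(** Completeness: sets of outer measure 0 are Caratheodory measurable. *)
Lemma negligible_lebesgue_rVP d (A : set 'rV[R]_d) :
  (lebesgue_rV R d).-negligible A <-> lebesgue_rV R d A = 0%E.
Proof.
split=> [[/= B [mB B0 AB]]|A0].
  by apply/eqP; rewrite eq_le outer_measure_ge0 andbT -B0 le_outer_measure.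
exists A; split => //=; apply: le_caratheodory_measurable => /= X.
have -> : ((borel_lebesgue_rV R d)^* (X `&` A))%mu = 0%E.
  apply/eqP; rewrite eq_le outer_measure_ge0 andbT -A0.
  by apply: le_outer_measure; exact: subIsetr.
by rewrite add0e; apply: le_outer_measure; exact: subIsetl.
Qed.

Lemma lebesgue_rV_shift_le d (v : 'rV[R]_d) (A : set 'rV[R]_d) :
  (lebesgue_rV R d (shift_rV v @^-1` A) <= lebesgue_rV R d A)%E.
Proof.
apply/le_ereal_inf_tmp => _ [F [mF AF] <-]; apply: ereal_inf_lbound.
exists (fun n => shift_rV v @^-1` F n).
  split=> [n|x /AF[n _ Fn]]; last by exists n.
  by rewrite -[X in measurable X]setTI; exact: measurable_shift_rV.
by apply: eq_eseriesr => n _; exact: borel_lebesgue_rV_shift.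
Qed.

Lemma negligible_shift d (v : 'rV[R]_d) (A : set 'rV[R]_d) :
  (lebesgue_rV R d).-negligible A ->
  (lebesgue_rV R d).-negligible (shift_rV v @^-1` A).
Proof.
move=> /negligible_lebesgue_rVP A0; apply/negligible_lebesgue_rVP/eqP.
by rewrite eq_le outer_measure_ge0 andbT -A0 lebesgue_rV_shift_le.
Qed.

End translation.

(** * Bounded remainder sets and multiples of a rotation *)

Section torus.
Context {R : realType} {d : nat}.
Implicit Types (a b v x : 'rV[R]_d) (m : 'rV[int]_d) (S P : set 'rV[R]_d).

Lemma int_rVD m m' : int_rV (m + m') = int_rV m + int_rV m' :> 'rV[R]_d.
Proof. by apply/rowP => i; rewrite !mxE rmorphD. Qed.

Lemma int_rVN m : int_rV (- m) = - int_rV m :> 'rV[R]_d.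
Proof. by apply/rowP => i; rewrite !mxE mulrNz. Qed.

Lemma chi_periodic S x m : chi S (x + int_rV m) = chi S x.
Proof.
rewrite /chi (reindex_fsbigT (+%R^~ (- m))); last first.
  by exists (+%R^~ m) => k /=; rewrite ?addrK ?subrK.
apply: eq_fsbigr => k _; congr (\1_S _ : R).
by rewrite -addrA -int_rVD addrCA subrr addr0.
Qed.

Definition floor_rV x : 'rV[int]_d := map_mx Num.floor x.

Lemma unit_cube_sub_floor x : unit_cube (x - int_rV (floor_rV x)).
Proof.
by move=> i; rewrite !mxE subr_ge0 floor_le ltrBlDl -(rmorphD _ _ 1) floorD1_gt.
Qed.

Lemma torus_aeS P Q : P `<=` Q -> torus_ae P -> torus_ae Q.
Proof.
by move=> PQ; apply: negligibleS; apply: subsetC => x /= + cx => /(_ cx)/PQ.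
Qed.

(** The part of a translate of the cube where the property fails is covered by
    the integer translates of the exceptional set in the cube itself, and there
    are countably many of them. *)
Lemma torus_ae_shift P v :
  (forall x m, P x -> P (x + int_rV m)) ->
  torus_ae P -> torus_ae [set x | P (x + v)].
Proof.
move=> periodicP aeP.
pose B m := shift_rV (v + int_rV m) @^-1` (~` [set x | unit_cube x -> P x]).
have negB m : (lebesgue_rV R d).-negligible (B m) by exact: negligible_shift.
have := negligible_bigcup (fun n => negB (odflt 0 (unpickle n))).
apply: negligibleS => x /= /not_implyP[_ nPx].
pose m := - floor_rV (x + v); exists (pickle m) => //.
rewrite pickleK /B/= /shift_rV => /(_ _)/wrap[].
  by rewrite /m addrA int_rVN; exact: unit_cube_sub_floor.
move=> /(periodicP _ (- m)); rewrite -!addrA -int_rVD subrr.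
by rewrite (_ : int_rV 0 = 0) ?addr0//; apply/rowP => i; rewrite !mxE.
Qed.

Lemma torus_ae_forall (P : nat -> set 'rV[R]_d) :
  (forall n, torus_ae (P n)) -> torus_ae [set x | forall n, P n x].
Proof.
move=> aeP; have := ae_foralln aeP; apply: filterS.
by move=> x Px cx n; exact: Px.
Qed.

Definition discrepancy S a n x : R :=
  \sum_(0 <= k < n) chi S (x + k%:R *: a) - n%:R * mes S.

Lemma discrepancy_periodic S a n x m :
  discrepancy S a n (x + int_rV m) = discrepancy S a n x.
Proof.
rewrite /discrepancy; congr (_ - _); apply: eq_bigr => k _.
by rewrite addrAC chi_periodic.
Qed.

Lemma discrepancyE S a n x :
  discrepancy S a n x = \sum_(0 <= k < n) (chi S (x + k%:R *: a) - mes S).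
Proof.
by rewrite /discrepancy sumrB sumr_const_nat subn0 mulr_natl.
Qed.

(** A backward orbit segment is a forward one read from its other end. *)
Lemma bounded_remainder_set_opp a S :
  bounded_remainder_set a S -> bounded_remainder_set (- a) S.
Proof.
move=> [bS mS [C hC]]; split => //; exists C => n n1.
have aeC : torus_ae [set x | `|discrepancy S a n x| <= C] := hC n n1.
have := torus_ae_shift (- (n.-1%:R *: a)) _ aeC.
move=> /(_ _)/wrap[]; first by move=> x m /=; rewrite discrepancy_periodic.
apply: torus_aeS => x /=.
rewrite /discrepancy big_nat_rev/= add0n; congr (`|_ - _| <= _).
apply: eq_big_nat => k /andP[_ kn]; congr (chi S _).
rewrite -addrA -[- (_ *: a)]scaleNr -scalerDl scalerN -scaleNr.
congr (_ + _ *: a); rewrite -subn1 !natrB//.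
by rewrite -addn1 natrD; lra.
Qed.

Lemma sum_residues (V : nmodType) (f : nat -> V) (q n : nat) :
  \sum_(0 <= k < q * n) f k =
  \sum_(0 <= j < n) \sum_(0 <= i < q) f (i * n + j)%N.
Proof.
rewrite big_nat_mul exchange_big/=; apply: eq_bigr => i _.
rewrite -{1}(add0n (i * n)%N) big_addn mulSn addnK.
by apply: eq_bigr => j _; rewrite addnC.
Qed.

(** The indices below the largest multiple of [n] are grouped by residue modulo
    [n]; the remaining ones, fewer than [n], are discrepancies at time 1 of
    translated points.  Hence the bound, twice [n] times the one for
    [n b + m]. *)
Lemma bounded_remainder_set_mul n b m S : (0 < n)%N ->
  bounded_remainder_set (n%:R *: b + int_rV m) S -> bounded_remainder_set b S.
Proof.
set a := _ + _ => n0 [bS mS [C hC]]; split => //.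
(* Time 0 is included, since there may be no complete block of length [n]. *)
have C0 q : torus_ae [set x | `|discrepancy S a q x| <= Num.max C 0].
  case: q => [|q].
    apply: aeW => x _ /=; rewrite discrepancyE big_geq// normr0.
    by rewrite le_max lexx orbT.
  by apply: torus_aeS (hC q.+1 isT) => x /= H; rewrite le_max H.
have shifts : torus_ae [set x | forall j q,
    `|discrepancy S a q (x + j%:R *: b)| <= Num.max C 0].
  apply: torus_ae_forall => j; apply: torus_ae_forall => q.
  apply: torus_ae_shift (C0 q) => x k /=.
  by rewrite discrepancy_periodic.
exists (n%:R * Num.max C 0 + n%:R * Num.max C 0) => N _.
move: shifts; apply: torus_aeS => x /= H.
rewrite -[X in `|X|]/(discrepancy S b N x) discrepancyE {1}(divn_eq N n).
set q := (N %/ n)%N; set r := (N %% n)%N; set C' := Num.max C 0 in H *.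
pose f k := chi S (x + k%:R *: b) - mes S.
rewrite -/(f _) (big_cat_nat (n := (q * n)%N)) ?leq_addr//=.
apply: (le_trans (ler_normD _ _)); apply: lerD.
  rewrite sum_residues; apply: le_trans (ler_norm_sum _ _ _) _.
  rewrite mulr_natl -[n in _ *+ n]subn0 -sumr_const_nat; apply: ler_sum => j _.
  have := H j q; rewrite discrepancyE; congr (`|_| <= _).
  apply: eq_bigr => i _.
  pose k : 'rV[int]_d := m *+ i.
  have int_k : int_rV k = i%:R *: int_rV m :> 'rV[R]_d.
    by apply/rowP => l; rewrite !mxE mulmxnE raddfMn mulr_natl.
  rewrite /f natrD natrM -(chi_periodic _ (x + _ *: b) k) int_k.
  congr (chi S _ - _).
  rewrite /a scalerDr scalerA scalerDl -!addrA; congr (_ + _).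
  by rewrite addrCA.
rewrite -{1}[(q * n)%N]add0n big_addn addKn.
apply: le_trans (ler_norm_sum _ _ _) _.
apply: (@le_trans _ _ (\sum_(0 <= i < r) C')).
  apply: ler_sum => j _; have := H (j + q * n)%N 1%N.
  by rewrite discrepancyE big_nat1 scale0r addr0.
rewrite sumr_const_nat subn0 -[_ *+ _]mulr_natl ler_wpM2r//.
  by rewrite /C' le_max lexx orbT.
by rewrite ler_nat ltnW// ltn_mod.
Qed.

Lemma bounded_remainder_set_rotation_group a b S : a \in rotation_group b ->
  a \notin range int_rV ->
  bounded_remainder_set a S -> bounded_remainder_set b S.
Proof.
rewrite inE => -[[n|n] _ [m _ <-]].
  case: n => [|n].
    by rewrite scale0r add0r => /negP[]; rewrite inE; exists m.
  by move=> _; exact: bounded_remainder_set_mul.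
move=> _ /bounded_remainder_set_opp.
rewrite NegzE mulrNz scaleNr opprD opprK -int_rVN.
exact: bounded_remainder_set_mul.
Qed.

End torus.

(** * Measure of the test sets *)

Lemma measurable_floor {R : realType} :
  measurable_fun setT
    (fun t : measurableTypeR R => (Num.floor t)%:~R : measurableTypeR R).
Proof.
by apply: nondecreasing_measurable => // x y xy; rewrite ler_int le_floor.
Qed.

Lemma measurable_arc_indic {R : realType} (a : R) :
  measurable_fun setT (arc_indic a : measurableTypeR R -> measurableTypeR R).
Proof.
apply: measurable_funB; first exact: measurable_floor.
rewrite (_ : (fun _ => _) = (fun t => (Num.floor t)%:~R) \o shift1 (- a))//.
by apply: measurableT_comp; [exact: measurable_floor|exact: measurable_shift1].
Qed.

(** A translate of the arc, cut at the origin of the circle, is one interval or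
    two according to whether the arc wraps around. *)
Lemma lebesgue_measure_arc {R : realType} (a c : R) : 0 <= a < 1 ->
  lebesgue_measure
    [set t : measurableTypeR R | 0 <= t < 1 /\ arc_indic a (t + c) = 1]
  = a%:E.
Proof.
move=> a01; have /andP[a0 a1] := a01.
pose n := Num.floor c; pose u := c - n%:~R.
have [u0 u1] : 0 <= u /\ u < 1.
  by have := floor_itv c; rewrite -/n rmorphD/= /u => /andP[]; split; lra.
have -> : [set t : measurableTypeR R | 0 <= t < 1 /\ arc_indic a (t + c) = 1] =
    [set t | 0 <= t < 1 /\ (t + u < a \/ 1 <= t + u < 1 + a)].
  apply/seteqP; split => t /= [/andP[t0 t1]].
    rewrite (_ : t + c = t + u + n%:~R); last by rewrite /u; lra.
    rewrite arc_indicDz; have [tu|tu] := ltP (t + u) 1.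
      rewrite (@arc_indicE _ _ _ 0)//; last first.
        by rewrite add0r; apply/andP; split; lra.
      case: ifP => [|_ /esym/eqP]; last by rewrite oner_eq0.
      by rewrite add0r => h _; split; [apply/andP|left].
    rewrite (@arc_indicE _ _ _ 1)//; last by apply/andP; split; lra.
    case: ifP => [|_ /esym/eqP]; last by rewrite oner_eq0.
    by move=> h _; split; [apply/andP|right; apply/andP].
  move=> h; split; first exact/andP.
  rewrite (_ : t + c = t + u + n%:~R); last by rewrite /u; lra.
  rewrite arc_indicDz; case: h => [h|/andP[h1 h2]].
    rewrite (@arc_indicE _ _ _ 0)//; last first.
        by rewrite add0r; apply/andP; split; lra.
    by rewrite add0r h.
  rewrite (@arc_indicE _ _ _ 1)//; last by apply/andP; split; lra.
  by rewrite h2.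
have [ua|au] := ltP u a.
  rewrite (_ : [set _ | _] = `[0, (a - u)[%classic `|` `[(1 - u), 1[%classic).
    transitivity (lebesgue_measure (`[0%R, (a - u)%R[%classic : set R) +
        lebesgue_measure (`[(1 - u)%R, 1%R[%classic : set R))%E.
      apply: measureU => //.
      apply/seteqP; split => // t []/=; rewrite !in_itv/=.
      by move=> /andP[? ?] /andP[? ?]; lra.
    rewrite !lebesgue_measure_itv/= !lte_fin ifT; last by lra.
    case: ifP => [_|h]; first by rewrite -!EFinB -EFinD; congr (_%:E); lra.
    by rewrite adde0 -EFinB; congr (_%:E); lra.
  apply/seteqP; split => t /=; rewrite !in_itv/=.
    move=> [/andP[t0 t1] [h|/andP[h1 h2]]]; [left|right];
      by apply/andP; split; lra.
  move=> [] /andP[h1 h2]; split; try (apply/andP; split; lra).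
    by left; lra.
  by right; apply/andP; split; lra.
rewrite (_ : [set _ | _] = `[(1 - u), (1 + a - u)[%classic).
  rewrite !lebesgue_measure_itv/= !lte_fin; case: ifP => h.
    by rewrite -!EFinB; congr (_%:E); lra.
  by congr (_%:E); lra.
apply/seteqP; split => t /=; rewrite !in_itv/=.
  by move=> [/andP[t0 t1] [h|/andP[h1 h2]]]; apply/andP; split; lra.
move=> /andP[h1 h2]; split; first by apply/andP; split; lra.
by right; apply/andP; split; lra.
Qed.

Lemma product_measure1_xsection_const d1 d2 (T1 : measurableType d1)
    (T2 : measurableType d2) (R : realType)
    (m1 : {sigma_finite_measure set T1 -> \bar R})
    (m2 : {sigma_finite_measure set T2 -> \bar R})
    (D : set T1) (A : set (T1 * T2)) (r : \bar R) : measurable D ->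
  (forall t, D t -> m2 (xsection A t) = r) ->
  (forall t, ~ D t -> xsection A t = set0) ->
  (m1 \x m2)%E A = (r * m1 D)%E.
Proof.
move=> mD hD hC; rewrite /product_measure1 -integral_cst// integral_mkcond.
apply: eq_integral => t _ /=; rewrite patchE; case: ifPn => [|].
  by rewrite inE => /hD.
by rewrite notin_setE => /hC ->; rewrite measure0.
Qed.

Section cube_arc.
Context {R : realType}.

Definition sum_on d (J : pred 'I_d) (x : 'rV[R]_d) : R :=
  \sum_(i | J i) x ord0 i.

(** The constant [c] is there for the induction of [borel_lebesgue_cube_arc],
    where it absorbs the coordinates that are already fixed. *)
Definition cube_arc d (J : pred 'I_d) (c a : R) : set 'rV[R]_d :=
  [set x | unit_cube x /\ arc_indic a (sum_on J x + c) = 1].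

Lemma measurable_unit_cube d : measurable (unit_cube : set 'rV[R]_d).
Proof.
rewrite (_ : unit_cube = \bigcap_(i in [set: 'I_d])
    (rV_coord i @^-1` `[0, 1[%classic)); last first.
  apply/seteqP; split => x /= cx i.
    by move=> _; rewrite /= in_itv; exact: cx.
  by have := cx i I; rewrite /= in_itv.
apply: fin_bigcap_measurable; first exact: finite_finset.
move=> i _; rewrite -[X in measurable X]setTI.
by apply: measurable_rV_coord => //; exact: measurable_itv.
Qed.

Lemma measurable_cube_arc d J c a : measurable (@cube_arc d J c a).
Proof.
rewrite (_ : cube_arc J c a = unit_cube `&`
  (arc_indic a \o (fun x => sum_on J x + c)) @^-1` [set 1])//.
apply: measurableI; first exact: measurable_unit_cube.
rewrite -[X in measurable X]setTI.
apply: measurableT_comp => //; first exact: measurable_arc_indic.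
apply: measurable_funD => //.
rewrite (_ : sum_on J = fun x => \sum_(i <- index_enum 'I_d)
    (if J i then rV_coord i x else 0)); last first.
  by apply/funext => x; rewrite /sum_on big_mkcond.
apply: measurable_sum => i; case: (J i) => //.
exact: measurable_rV_coord.
Qed.

Lemma borel_lebesgue_unit_cube d : borel_lebesgue_rV R d unit_cube = 1%E.
Proof.
have := @borel_lebesgue_rV_box R d (fun=> `[0, 1[%classic).
rewrite (_ : [set x | _] = unit_cube); last first.
  by apply/seteqP; split => x cx i; have := cx i; rewrite /= in_itv.
move=> -> //; rewrite big1// => i _.
by rewrite lebesgue_measure_itv/= lte01 sube0.
Qed.

(** Slicing along the first coordinate, each slice is a set of the same kind in
    one dimension less, with the same measure, as long as [J] contains another
    coordinate; otherwise the set is the product of an arc and a cube. *)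
Lemma borel_lebesgue_cube_arc d (J : pred 'I_d) i0 (c a : R) : J i0 ->
  0 <= a < 1 -> borel_lebesgue_rV R d (cube_arc J c a) = a%:E.
Proof.
move=> Ji0 a01; elim: d J i0 c Ji0 => [|d IHd] J i0 c Ji0.
  by case: i0 Ji0.
pose J' j := J (lift ord0 j).
have sumE t (x : 'rV[R]_d) : sum_on J (cons_rV (t, x)) =
    (if J ord0 then t else 0) + sum_on J' x.
  rewrite /sum_on big_mkcond big_ord_recl/= mxE unlift_none; congr (_ + _).
  by rewrite [RHS]big_mkcond; apply: eq_bigr => j _; rewrite mxE liftK.
have cubeE t (x : 'rV[R]_d) :
    unit_cube (cons_rV (t, x)) <-> 0 <= t < 1 /\ unit_cube x.
  split=> [cx|[ct cx] i].
    split; first by have := cx ord0; rewrite mxE unlift_none.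
    by move=> j; have := cx (lift ord0 j); rewrite mxE liftK.
  by rewrite mxE; case: unliftP => [j _|_].
rewrite /= /lebesgue_step /pushforward.
have [[j0 J'j0]|noJ'] := pselect (exists j, J' j).
  pose D : set (measurableTypeR R) := `[0, 1[%classic.
  have D1 : lebesgue_measure D = 1%E.
    by rewrite lebesgue_measure_itv/= lte01 sube0.
  rewrite -[RHS]mule1 -D1; apply: product_measure1_xsection_const.
  - exact: measurable_itv.
  - move=> t; rewrite /D/= in_itv/= => t01.
    rewrite -(IHd _ j0 ((if J ord0 then t else 0) + c) J'j0).
    congr (borel_lebesgue_rV R d _); apply/seteqP; split => x.
      rewrite /= xsectionE/= /cube_arc/= sumE => -[/cubeE[_ cx]].
      by rewrite addrCA addrA.
    rewrite xsectionE /cube_arc/= sumE => -[cx].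
    by rewrite addrCA addrA; split => //; exact/cubeE.
  - move=> t; rewrite /D/= in_itv/= => t01.
    apply/seteqP; split => // x.
    by rewrite xsectionE /cube_arc/= => -[/cubeE[]].
have Jord0 : J ord0.
  by move: Ji0; case: (unliftP ord0 i0) => [j ->|->]// Jj; case: noJ'; exists j.
rewrite (_ : _ @^-1` _ =
  [set t | 0 <= t < 1 /\ arc_indic a (t + c) = 1] `*` unit_cube).
  rewrite product_measure1E.
  - by rewrite borel_lebesgue_unit_cube mule1; exact: lebesgue_measure_arc.
  - rewrite (_ : [set t | _] = [set t | 0 <= t < 1] `&`
      (arc_indic a \o shift1 c) @^-1` [set 1])//.
    apply: measurableI; first by rewrite -set_itvE; exact: measurable_itv.
    rewrite -[X in measurable X]setTI.
    apply: measurableT_comp => //; first exact: measurable_arc_indic.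
    exact: measurable_shift1.
  - exact: measurable_unit_cube.
have J'0 (x : 'rV[R]_d) : sum_on J' x = 0.
  by rewrite /sum_on big_pred0// => j; apply/negP => J'j; case: noJ'; exists j.
apply/seteqP; split => -[t x]; rewrite /cube_arc/= sumE Jord0 J'0 addr0.
  by move=> [/cubeE[]].
by move=> [[t01 ?] cx]; split => //; exact/cubeE.
Qed.

End cube_arc.

(** * Discrepancy of the test sets *)

Section test_sets.
Context {R : realType} {d : nat}.
Implicit Types (x : 'rV[R]_d) (S : set 'rV[R]_d) (J : pred 'I_d).

Lemma sum_onD J x y : sum_on J (x + y) = sum_on J x + sum_on J y.
Proof. by rewrite /sum_on -big_split/=; apply: eq_bigr => i _; rewrite mxE. Qed.

Lemma sum_onZ J (k : R) x : sum_on J (k *: x) = k * sum_on J x.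
Proof. by rewrite /sum_on big_distrr/=; apply: eq_bigr => i _; rewrite mxE. Qed.

Lemma sum_on_int_rV J (m : 'rV[int]_d) :
  sum_on J (int_rV m : 'rV[R]_d) = (\sum_(i | J i) m ord0 i)%:~R.
Proof. by rewrite /sum_on rmorph_sum/=; apply: eq_bigr => i _; rewrite mxE. Qed.

Lemma chi_sub_unit_cube S x : S `<=` unit_cube ->
  chi S x = \1_S (x - int_rV (floor_rV x)).
Proof.
move=> Scube; rewrite /chi -int_rVN.
rewrite -(fsbig_widen [set - floor_rV x])//; first by rewrite fsbig_set1.
move=> k [_ /= kx]; rewrite /= indicE memNset// => /Scube cx; apply: kx.
apply/rowP => i; have := cx i; rewrite !mxE => /andP[h0 h1].
rewrite (@floor_def _ _ (- k ord0 i)) ?opprK//.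
by rewrite rmorphD/= !mulrNz; apply/andP; split; lra.
Qed.

Lemma chi_cube_arc J (a : R) x : 0 <= a < 1 ->
  chi (cube_arc J 0 a) x = arc_indic a (sum_on J x).
Proof.
move=> a01; rewrite chi_sub_unit_cube; last by move=> y [].
rewrite -[in RHS](subrK (int_rV (floor_rV x)) x).
rewrite sum_onD sum_on_int_rV arc_indicDz.
have [h|h] := arc_indic01 (sum_on J (x - int_rV (floor_rV x))) a01.
  rewrite h indicE memNset//= => -[_]; rewrite addr0 h => /esym/eqP.
  by rewrite oner_eq0.
rewrite h indicE mem_set//; split; last by rewrite addr0.
exact: unit_cube_sub_floor.
Qed.

Lemma bounded_unit_cube : bounded_set (unit_cube : set 'rV[R]_d).
Proof.
exists 1; split; first by rewrite num_real.
move=> M M1 x cx; apply: le_trans (ltW M1); rewrite /Num.norm/=.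
have [->|/mx_norm_neq0[[i j] ->]/=] := eqVneq (mx_norm x) 0; first exact: ler01.
by rewrite (ord1 i); have := cx j => /andP[? ?]; rewrite ger0_norm// ltW.
Qed.

Lemma mes_cube_arc J i0 (a : R) : J i0 -> 0 <= a < 1 ->
  mes (cube_arc J 0 a) = a.
Proof.
move=> Ji0 a01; rewrite /mes lebesgue_rVE; last exact: measurable_cube_arc.
by rewrite (borel_lebesgue_cube_arc _ Ji0).
Qed.

Lemma discrepancy_cube_arc J i0 (a : R) b n x : J i0 -> 0 <= a < 1 ->
  discrepancy (cube_arc J 0 a) b n x = arc_sum a (sum_on J b) n (sum_on J x).
Proof.
move=> Ji0 a01; rewrite /discrepancy /arc_sum (mes_cube_arc Ji0 a01).
by congr (_ - _); apply: eq_bigr => k _; rewrite chi_cube_arc// sum_onD sum_onZ.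
Qed.

Lemma bounded_remainder_set_cube_arc J i0 (alpha : 'rV[R]_d) : J i0 ->
  let s := sum_on J alpha in
  bounded_remainder_set alpha (cube_arc J 0 (s - (Num.floor s)%:~R)).
Proof.
move=> Ji0 s; set a := s - _.
have a01 : 0 <= a < 1.
  by rewrite subr_ge0 floor_le ltrBlDl -(rmorphD _ _ 1) floorD1_gt.
split.
- have [M [rM hM]] := bounded_unit_cube; exists M; split => // M' /hM {}hM x.
  by move=> [cx _]; exact: hM.
- exact: caratheodory_measurable_mu_ext (measurable_cube_arc _ _ _).
exists 1 => n _; apply: aeW => x _ /=.
rewrite -[X in `|X|]/(discrepancy (cube_arc J 0 a) alpha n x).
rewrite (discrepancy_cube_arc _ _ _ Ji0 a01).
rewrite (_ : sum_on J alpha = a + (Num.floor s)%:~R) ?arc_sum_hecke//.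
by rewrite /a subrK.
Qed.

(** Boxes are not negligible. *)
Lemma torus_ae_box (P : set 'rV[R]_d) (l : 'I_d -> R) (eta : R) : 0 < eta ->
  (forall i, 0 <= l i /\ l i + eta <= 1) -> torus_ae P ->
  exists2 x : 'rV[R]_d, (forall i, l i <= x ord0 i < l i + eta) & P x.
Proof.
move=> eta0 hl aeP; apply: contrapT => noP.
pose I i : set (measurableTypeR R) := `[l i, (l i + eta)[%classic.
pose B := [set x : 'rV[R]_d | forall i, I i (x ord0 i)].
have mB : measurable B.
  rewrite (_ : B = \bigcap_(i in [set: 'I_d])
(rV_coord i @^-1` I i)); last first.
    by apply/seteqP; split => x Bx i; [move=> _|]; exact: Bx.
  apply: fin_bigcap_measurable; first exact: finite_finset.
  move=> i _; rewrite -[X in measurable X]setTI.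
  by apply: measurable_rV_coord => //; exact: measurable_itv.
have : (lebesgue_rV R d).-negligible B.
  apply: negligibleS aeP => x Bx /= Px; apply: noP; exists x.
    by move=> i; have := Bx i; rewrite /I/= in_itv.
  apply: Px => i; have := Bx i; rewrite /I/= in_itv/= => /andP[? ?].
  by have [? ?] := hl i; apply/andP; split; lra.
move=> /negligible_lebesgue_rVP; rewrite lebesgue_rVE//.
rewrite (borel_lebesgue_rV_box (A := I)); last first.
  by move=> i; exact: measurable_itv.
rewrite (eq_bigr (fun=> eta%:E)); last first.
  move=> i _; rewrite /I lebesgue_measure_itv/= lte_fin ltrDl eta0 -EFinB.
  by congr (_%:E); lra.
rewrite prodEFin => -[]/eqP; rewrite prodf_seq_eq0 => /hasP[i _ /=].
by rewrite gt_eqF.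
Qed.

(** The sum is constant from [t] to [t + e], and the points [x] of a
    small box whose corner has a coordinate [t] at [i0] and 0 elsewhere have
    their [sum_on J x] in this interval; one of them is not exceptional. *)
Lemma bounded_arc_sum_of_ae J i0 (a C : R) b : J i0 ->
  (forall n, (1 <= n)%N ->
    torus_ae [set x | `|arc_sum a (sum_on J b) n (sum_on J x)| <= C]) ->
  forall n t, `|arc_sum a (sum_on J b) n t| <= Num.max C 0.
Proof.
move=> Ji0 hC [|n] t.
  by rewrite /arc_sum big_geq// mul0r subr0 normr0 le_max lexx orbT.
wlog t01 : t / 0 <= t < 1.
  move=> H; have := H (t - (Num.floor t)%:~R).
  rewrite -(arc_sumDz _ _ _ _ (Num.floor t)) subrK; apply.
  by rewrite subr_ge0 floor_le ltrBlDl -(rmorphD _ _ 1) floorD1_gt.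
have /andP[t0 t1] := t01.
have [e e0 he] := arc_sum_right_constant a (sum_on J b) t n.+1.
(* The side [e / d.+1] keeps sums of at most [d] coordinates below [t + e], the
   side [1 - t] keeps the box inside the unit cube. *)
pose eta := Num.min (e / d.+1%:R) (1 - t).
have eta0 : 0 < eta by rewrite lt_min divr_gt0//= subr_gt0.
have [eta_e eta_t] : eta <= e / d.+1%:R /\ eta <= 1 - t.
  by rewrite !ge_min !lexx orbT.
pose l i := if i == i0 then t else 0.
have [|x hx] := torus_ae_box eta0 _ (hC n.+1 isT) (l := l).
  by move=> i; rewrite /l; case: eqP => _; split; lra.
rewrite /= he; first by move=> h; rewrite le_max h.
have El : \sum_(i | J i) l i = t.
  rewrite (bigD1 i0)//= /l eqxx big1 ?addr0// => i /andP[_ /negbTE ->].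
  by [].
rewrite -{1}El -{1}El /sum_on; apply/andP; split.
  by apply: ler_sum => i _; have /andP[] := hx i.
apply: (@le_lt_trans _ _ (\sum_(i | J i) l i + \sum_(i | J i) eta)).
  rewrite -big_split/=; apply: ler_sum => i _; have /andP[_ h] := hx i.
  exact: ltW.
rewrite El ltrD2l sumr_const; apply: (@le_lt_trans _ _ (d%:R * eta)).
  rewrite -[_ *+ _]mulr_natl ler_wpM2r//; first exact: ltW.
  by rewrite ler_nat -[d in (_ <= d)%N]card_ord max_card.
have : d.+1%:R * eta <= e by rewrite mulrC -ler_pdivlMr.
by rewrite -natr1; lra.
Qed.

Lemma irrational_sum_on J i0 (b : 'rV[R]_d) : irrational_vector b -> J i0 ->
  forall k l : int, k%:~R * sum_on J b + l%:~R = 0 -> k = 0.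
Proof.
move=> irrb Ji0 k l kl.
have [] := irrb l%:~R (fun i => if J i then k%:~R else 0).
  rewrite mulr1 ratr_int -[RHS]kl addrC; congr (_ + _).
  rewrite /sum_on big_distrr/= [RHS]big_mkcond; apply: eq_bigr => i _.
  by case: ifP => _; rewrite ?ratr_int// rmorph0 mul0r.
move=> _ /(_ i0); rewrite Ji0 => /eqP; rewrite intr_eq0 => /eqP//.
Qed.

Lemma sum_on_rotation_group J i0 (alpha beta : 'rV[R]_d) :
  irrational_vector beta -> J i0 ->
  (forall S, bounded_remainder_set alpha S -> bounded_remainder_set beta S) ->
  exists n m : int, sum_on J alpha = n%:~R * sum_on J beta + m%:~R.
Proof.
move=> irrb Ji0 /(_ _ (bounded_remainder_set_cube_arc alpha Ji0)).
set s := sum_on J alpha; set a := s - _.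
have a01 : 0 <= a < 1.
  by rewrite subr_ge0 floor_le ltrBlDl -(rmorphD _ _ 1) floorD1_gt.
move=> [_ _ [C hC]].
have hC' n : (1 <= n)%N ->
    torus_ae [set x | `|arc_sum a (sum_on J beta) n (sum_on J x)| <= C].
  move=> /hC; apply: torus_aeS => x /=.
  rewrite -[X in `|X|]/(discrepancy (cube_arc J 0 a) beta n x).
  by rewrite (discrepancy_cube_arc _ _ _ Ji0 a01).
have [n [m Ea]] := bounded_arc_sum_rotation (irrational_sum_on irrb Ji0)
  (bounded_arc_sum_of_ae Ji0 hC').
by exists n, (m + Num.floor s); rewrite rmorphD/= addrA -Ea /a subrK.
Qed.

End test_sets.

(** * The comparison theorem *)

Theorem corollary5 (R : realType) (d : nat) (hd : (1 <= d)%N)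
    (alpha beta : 'rV[R]_d)
    (halpha : irrational_vector alpha) (hbeta : irrational_vector beta) :
  (forall S : set 'rV[R]_d,
     bounded_remainder_set alpha S -> bounded_remainder_set beta S) <->
  alpha \in rotation_group beta.
Proof.
split=> [brs|alpha_beta S].
  have [n [m Esum]] := sum_on_rotation_group (J := predT) (i0 := Ordinal hd)
    hbeta isT brs.
  have coord i : exists nm : int * int,
      alpha ord0 i = nm.1%:~R * beta ord0 i + nm.2%:~R.
    have [ni [mi]] := sum_on_rotation_group (J := pred1 i) (i0 := i)
      hbeta (eqxx i) brs.
    by rewrite /sum_on !big_pred1_eq => E; exists (ni, mi).
  have [nm Enm] := choice coord.
  have [] := hbeta (\sum_i (nm i).2 - m)%:~R (fun i => ((nm i).1 - n)%:~R).
    move: Esum; rewrite /sum_on (eq_bigr _ (fun i _ => Enm i)) big_split/=.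
    move=> /eqP; rewrite -subr_eq0 => /eqP E.
    rewrite -[RHS]E mulr1 ratr_int rmorphB/= rmorph_sum/=.
    rewrite [X in _ + X = _](eq_bigr
      (fun i => (nm i).1%:~R * beta ord0 i - n%:~R * beta ord0 i)).
      by rewrite sumrB -mulr_sumr; lra.
    by move=> i _; rewrite ratr_int rmorphB/= mulrBl.
  move=> _ En; rewrite inE; exists n => //; exists (\row_i (nm i).2) => //.
  apply/rowP => i; rewrite !mxE Enm.
  by have /eqP := En i; rewrite intr_eq0 subr_eq0 => /eqP ->.
apply: bounded_remainder_set_rotation_group => //.
apply/negP; rewrite inE => -[m _ Em].
have [|_ /(_ (Ordinal hd))] := halpha (- (m ord0 (Ordinal hd)))%:~R
  (fun i => (i == Ordinal hd)%:R).
  rewrite mulr1 ratr_int (bigD1 (Ordinal hd))//= big1 ?addr0; last first.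
    by move=> i /negbTE ->; rewrite rmorph0 mul0r.
  by rewrite -Em mxE rmorph1 mul1r mulrNz addNr.
by rewrite eqxx => /eqP; rewrite oner_eq0.
Qed.
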